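(* Let $n\geq 7$ be an integer. Then the prime difference graph $G_n$ contains any 2-factor of the complete graph of order $n$ as a subgraph; that is, for every 2-factor $F$ of the complete graph $K_n$ on $n$ vertices, $G_n$ has a subgraph isomorphic to $F$.
   Context: For a positive integer $n$, the prime difference graph $G_n$ of order $n$ is the graph with vertex set $\{1,2,\dots,n\}$ in which two vertices $u,v$ are adjacent if and only if $|u-v|$ is a prime number. A 2-factor of a graph $G$ is a spanning subgraph of $G$ in which every vertex has degree two, i.e. a collection of vertex-disjoint cycles (each of length at least 3) that together cover every vertex of $G$ exactly once. *)

(* Defs.v *)
From HB Require Import structures.
From mathcomp Require Import all_boot all_order all_algebra.

Set Implicit Arguments.
Unset Strict Implicit.
Unset Printing Implicit Defensive.

Record sgraph := SGraph {
  vertex :> finType;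
  adj : rel vertex;
  adj_sym : symmetric adj;
  adj_irr : irreflexive adj
}.

Definition degree (G : sgraph) (v : G) : nat := #|[set w : G | adj v w]|.

Definition isomorphic (G H : sgraph) : Prop :=
  exists f : G -> H, bijective f /\ forall u v : G, adj (f u) (f v) = adj u v.

Record subgraph (G : sgraph) := Subgraph {
  sub_vertices : {set G};
  sub_adj : rel G;
  sub_adj_sym : symmetric sub_adj;
  sub_adjP : forall u v : G, sub_adj u v ->
    [/\ u \in sub_vertices, v \in sub_vertices & adj u v]
}.

Section GraphOfSubgraph.
Variables (G : sgraph) (H : subgraph G).

Let V := {x : G | x \in sub_vertices H}.
Let e : rel V := fun u v => sub_adj H (val u) (val v).

Fact graph_of_sym : symmetric e.
Proof. by move=> u v; apply: sub_adj_sym. Qed.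

Fact graph_of_irr : irreflexive e.
Proof. by move=> u; apply/negP => /sub_adjP [_ _]; rewrite adj_irr. Qed.

Definition graph_of : sgraph := SGraph graph_of_sym graph_of_irr.
End GraphOfSubgraph.

Coercion graph_of : subgraph >-> sgraph.

Definition spanning (G : sgraph) (H : subgraph G) : Prop :=
  sub_vertices H = [set: G].

(* The cycles of a 2-factor have length at least 3 because graphs are simple. *)
Definition two_factor (G : sgraph) (F : subgraph G) : Prop :=
  spanning F /\ forall v : F, degree v = 2.

(* In the two graphs below, u : 'I_n stands for the vertex u.+1 of
   {1, ..., n}. *)

Definition complete_rel n : rel 'I_n := fun u v => u != v.

Fact complete_sym n : symmetric (@complete_rel n).
Proof. by move=> u v; rewrite /complete_rel eq_sym. Qed.

Fact complete_irr n : irreflexive (@complete_rel n).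
Proof. by move=> u; rewrite /complete_rel eqxx. Qed.

Definition complete_graph n : sgraph :=
  SGraph (@complete_sym n) (@complete_irr n).

Definition prime_difference_rel n : rel 'I_n :=
  fun u v => prime `|u.+1 - v.+1|%N.

Fact prime_difference_sym n : symmetric (@prime_difference_rel n).
Proof. by move=> u v; rewrite /prime_difference_rel distnC. Qed.

Fact prime_difference_irr n : irreflexive (@prime_difference_rel n).
Proof. by move=> u; rewrite /prime_difference_rel distnn. Qed.

Definition prime_difference_graph n : sgraph :=
  SGraph (@prime_difference_sym n) (@prime_difference_irr n).

(* Main.v *)
Require Import Defs.
From mathcomp Require Import all_boot all_order all_algebra.
From mathcomp Require Import zify.

Set Implicit Arguments.
Unset Strict Implicit.
Unset Printing Implicit Defensive.

(** A 2-factor of the complete graph of order n is, up to isomorphism, the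
    multiset of its cycle lengths: integers that are at least 3 and add up to
    n. So one has to cover [0, n) by disjoint cycles of these lengths, all of
    whose edges join integers at prime distance. Once the cycles of the
    2-factor are listed (cycle_decomposition) and the numerical problem is
    solved (packable_ge7), matching the two lists of cycles position by position
    gives a bijection sending edges to prime differences, and the
    subgraph of the prime difference graph is the image of the 2-factor under
    it (two_regular_embedding).

    The numerical problem is invariant under translation, so solutions for two
    multisets of lengths can be put side by side (packable_cat). This leaves
    finitely many families of blocks. A single length k >= 5 is a block:
    the integers in [0, k) form a cycle of prime differences. The lengths 3 and
    4 are not, because no triangle lies within 3 consecutive integers and no
    4-cycle within 4 of them; they are grouped with each other, as in 3 + 4,
    4 + 4 or 3 + 3 + 3. The only multisets of 3s and 4s that resist are 3,
    3 + 3 and 4. Their sum is less than 7, so a length k >= 5 is then present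
    and one uses the blocks k + 3, k + 3 + 3 and k + 4.

    The blocks that contain an arbitrary k >= 5 are built by induction on k, in
    steps of 5. If the cycle of length k uses the edge between n - 3 and n - 1,
    where [0, n) is the interval covered, this edge can be rerouted through the
    next five integers so that the longer cycle uses the edge between n + 2
    and n + 4 (growableD5). Only explicit cycles for 5 <= k <= 9 are needed. *)

(** * Cycles of a graph in which all degrees are two *)

Lemma next_neq_prev (T : eqType) (c : seq T) x :
  uniq c -> 2 < size c -> x \in c -> next c x != prev c x.
Proof.
move=> Uc c_gt2 c_x; apply/eqP => eq_np.
have [i p def_c] := rot_to c_x.
have Up : uniq (x :: p) by rewrite -def_c rot_uniq.
have: 2 < size (x :: p) by rewrite -def_c size_rot.
have: next (x :: p) x = prev (x :: p) x.
  by rewrite -def_c next_rot // prev_rot.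
rewrite prev_nth mem_head memNindex; last by case/andP: Up.
case: p {def_c} Up => [|y [|z p]] //= /and4P[_ y'p _ _].
rewrite eqxx nth_last /= => def_y _; case/negP: y'p.
by rewrite def_y mem_last.
Qed.

Section TwoRegular.
Variables (T : finType) (e : rel T).
Hypotheses (e_sym : symmetric e) (e_irr : irreflexive e).
Hypothesis e_two : forall x, #|[set y | e x y]| = 2.

Lemma other_neighbor x y : e x y -> exists2 z, e x z & z != y.
Proof.
move=> exy; have /eqP := e_two x.
rewrite (cardsD1 y) inE exy eqSS => /cards1P[z def_z].
by exists z; have := set11 z; rewrite -def_z !inE => /andP[].
Qed.

Lemma neighbors x y z t : e x y -> e x z -> y != z -> e x t -> t \in [:: y; z].
Proof.
move=> exy exz neq_yz ext.
suff /setP/(_ t): [set y; z] = [set u | e x u] by rewrite !inE ext.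
apply/eqP; rewrite eqEcard e_two cards2 neq_yz andbT.
by apply/subsetP => u; rewrite !inE => /orP[] /eqP->.
Qed.

Section ClosedSet.
Variable A : {set T}.
Hypothesis A_closed : forall x y, x \in A -> e x y -> y \in A.

(** The path x, y, ... grows from its end x as long as possible: x has a
    neighbour z other than y, and if z already occurs in the path then the part
    of the path from x to z closes up, the tail beyond z being dropped. The set A
    stands for the vertices outside the cycles already extracted. *)
Lemma path_cycle x y p :
    path e x (y :: p) -> uniq [:: x, y & p] -> {subset [:: x, y & p] <= A} ->
  exists c, [/\ cycle e c, uniq c, 2 < size c & {subset c <= A}].
Proof.
have [m] := ubnP (#|T| - size p).
elim: m => // m IHm in x y p *; rewrite ltnS => le_m exp Up sA.
have /=/andP[exy epp] := exp.
have [z exz neq_zy] := other_neighbor exy.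
have neq_zx : z != x by apply: contraTneq exz => ->; rewrite e_irr.
have [p_z | p'z] := boolP (z \in p).
  have [p1 [p2 def_p]] : exists p1 p2, p = rcons p1 z ++ p2.
    by case/path.splitP: p_z => p1 p2; exists p1, p2.
  exists [:: x, y & rcons p1 z]; split=> //=.
  - move: epp; rewrite def_p cat_path => /andP[epz _].
    by rewrite rcons_path last_rcons exy epz e_sym exz.
  - by move: Up; rewrite def_p -!cat_cons cat_uniq => /andP[].
  - by rewrite size_rcons.
  - by move=> t t_c; apply: sA; rewrite def_p -!cat_cons mem_cat t_c.
have Uz : uniq [:: z, x, y & p] by rewrite cons_uniq Up !inE !negb_or neq_zx neq_zy p'z.
apply: (IHm z x (y :: p)) => //.
- have: size [:: z, x, y & p] <= #|T| by rewrite -(card_uniqP Uz) max_card.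
  by move: le_m => /=; move: #|T| (size p) => k l; lia.
- by rewrite /= e_sym exz.
move=> t; rewrite inE => /predU1P[-> | /sA//].
by apply: A_closed exz; apply: sA; rewrite mem_head.
Qed.

Lemma closed_has_cycle x : x \in A ->
  exists c, [/\ cycle e c, uniq c, 2 < size c & {subset c <= A}].
Proof.
move=> Ax; have /card_gt0P[y] : 0 < #|[set y | e x y]| by rewrite e_two.
rewrite inE => exy; have Ay := A_closed Ax exy.
apply: (@path_cycle x y [::]); rewrite /= ?exy ?inE ?andbT //.
  by apply: contraTneq exy => ->; rewrite e_irr.
by move=> t; rewrite !inE => /orP[] /eqP->.
Qed.

End ClosedSet.

(** The successor and the predecessor of x in a cycle of length at least 3 are
    distinct, so they exhaust the two neighbours of x. *)
Lemma cycle_neighbors c x y : cycle e c -> uniq c -> 2 < size c -> x \in c ->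
  e x y -> (y == next c x) || (y == prev c x).
Proof.
move=> ec Uc c_gt2 c_x exy.
have e_prev : e x (prev c x) by rewrite e_sym prev_cycle.
have := neighbors (next_cycle ec c_x) e_prev (next_neq_prev Uc c_gt2 c_x) exy.
by rewrite !inE.
Qed.

(** Removing a cycle from a set that is closed under adjacency leaves a closed
    set, since by cycle_neighbors no edge leaves the cycle. *)
Lemma cycle_decomposition :
  exists ss : seq (seq T),
    [/\ uniq (flatten ss), flatten ss =i T, all (cycle e) ss
      & all (fun c => 2 < size c) ss].
Proof.
suff [ss [Uss defT ess ss_gt2]]: exists ss : seq (seq T),
    [/\ uniq (flatten ss), flatten ss =i [set: T], all (cycle e) ss
      & all (fun c => 2 < size c) ss].
  by exists ss; split=> // x; rewrite defT inE.
have: forall x y : T, x \in [set: T] -> e x y -> y \in [set: T] by [].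
have [m] := ubnP #|[set: T]|; elim: m [set: T] => // m IHm A le_m A_closed.
have [-> | [x Ax]] := set_0Vmem A.
  by exists [::]; split=> // x; rewrite inE.
have [c [ec Uc c_gt2 sA]] := closed_has_cycle A_closed Ax.
have [||ss [Uss defA ess ss_gt2]] := IHm (A :\: [set y in c]).
- rewrite -ltnS; apply: leq_trans le_m; rewrite ltnS; apply: proper_card.
  rewrite properE subsetDl; case: c c_gt2 sA {ec Uc} => // x0 c _ sA.
  apply/subsetPn; exists x0; first by rewrite sA ?mem_head.
  by rewrite !inE eqxx.
- move=> y z; rewrite !inE => /andP[c'y Ay] eyz; have ezy : e z y by rewrite e_sym.
  rewrite (A_closed _ _ Ay eyz) andbT; apply: contra c'y => c_z.
  by case/orP: (cycle_neighbors ec Uc c_gt2 c_z ezy)=> /eqP->; rewrite (mem_next, mem_prev).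
exists (c :: ss); split=> /=; try by apply/andP.
  rewrite cat_uniq Uc Uss andbT /=.
  by apply/hasPn => y; rewrite defA !inE => /andP[].
move=> y; rewrite mem_cat defA !inE.
by case: (boolP (y \in c)) => [/sA|].
Qed.

End TwoRegular.

(** * Packing an interval with cycles of prime differences *)

Definition prime_dist : rel nat := fun u v => prime `|u - v|%N.

Lemma prime_dist_sym : symmetric prime_dist.
Proof. by move=> u v; rewrite /prime_dist distnC. Qed.

Lemma prime_distDr d u v : prime_dist (u + d) (v + d) = prime_dist u v.
Proof. by rewrite /prime_dist distnDr. Qed.

Lemma prime_difference_relE n (u v : 'I_n) :
  prime_difference_rel u v = prime_dist u v.
Proof. by rewrite -(prime_distDr 1) !addn1. Qed.

Definition packing n (pp : seq (seq nat)) : bool :=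
  all (cycle prime_dist) pp && perm_eq (flatten pp) (iota 0 n).

(** The lengths are prescribed up to order only, so that packings of several
    intervals can be combined in any order. *)
Definition packable (s : seq nat) : Prop :=
  exists2 pp, perm_eq (shape pp) s & packing (sumn s) pp.

Lemma packing_packable n pp : packing n pp -> packable (shape pp).
Proof.
move=> pack_pp; exists pp => //; have /andP[_ /perm_size] := pack_pp.
by rewrite size_flatten size_iota => ->.
Qed.

Lemma perm_packable s t : perm_eq s t -> packable s -> packable t.
Proof.
move=> eq_st [pp pp_s]; rewrite (perm_sumn eq_st) => pack_pp.
by exists pp => //; apply: perm_trans eq_st.
Qed.

Lemma packable_cat s t : packable s -> packable t -> packable (s ++ t).
Proof.
case=> [pp pp_s /andP[pd_pp pp_iota]] [qq qq_t /andP[pd_qq qq_iota]].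
exists (pp ++ map (map (addn^~ (sumn s))) qq).
  rewrite /shape map_cat -map_comp (eq_map (size_map _)).
  exact: perm_cat.
apply/andP; split.
  rewrite all_cat pd_pp all_map; apply: sub_all pd_qq => c /=.
  by rewrite cycle_map; apply: sub_cycle => u v /=; rewrite prime_distDr.
rewrite flatten_cat -map_flatten sumn_cat iotaD perm_cat //.
by rewrite addnC iotaDl (eq_map (addnC _)) perm_map.
Qed.

(** A packing of [0, m + 3) by cycles of lengths k and r whose cycle of length k
    uses the edge between m and m + 2, the place where it can be lengthened. The
    cycle is read from m, so that this edge is the one that closes it. *)
Definition growable (r : seq nat) k : Prop :=
  exists m q pp, [/\ size (m :: q) = k, last m q = m + 2, shape pp = r
                   & packing (m + 3) ((m :: q) :: pp)].

Lemma packing_growable m q pp :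
    (last m q == m + 2) && packing (m + 3) ((m :: q) :: pp) ->
  growable (shape pp) (size q).+1.
Proof. by case/andP=> /eqP def_last pack_qpp; exists m, q, pp. Qed.

Lemma growable_packable r k : growable r k -> packable (k :: r).
Proof. by case=> m [q [pp [<- _ <-]]] /packing_packable. Qed.

(** The edge between m and m + 2 gives way to the path
      m, m + 3, m + 6, m + 4, m + 7, m + 5, m + 2,
    with differences 3, 3, 2, 3, 2, 3. It covers the five new integers and uses
    the edge between m + 5 and m + 7, which plays the same role for the
    interval [0, m + 8). *)
Lemma growableD5 r k : growable r k -> growable r (k + 5).
Proof.
case=> m [q [pp [size_q last_q shape_pp]]].
rewrite /packing /= => /andP[/andP[pd_q pd_pp] /permP iota_qpp].
(* The reversal makes the new cycle start at m + 5 and end at m + 7. *)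
exists (m + 5), (rev (m :: q) ++ [:: m + 3; m + 6; m + 4; m + 7]), pp.
split=> //.
- by rewrite /= size_cat size_rev size_q -addnS.
- by rewrite last_cat /= -addnA.
have pdD a b : prime_dist (m + a) (m + b) = prime_dist a b.
  by rewrite !(addnC m) prime_distDr.
have pd_rev : path prime_dist (m + 5) (rev (m :: q)).
  rewrite lastI rev_rcons /= last_q pdD -last_q rev_path.
  rewrite (eq_path (e' := prime_dist)) => [|u v]; last exact: prime_dist_sym.
  by move: pd_q; rewrite rcons_path => /andP[].
apply/andP; split.
  rewrite /= pd_pp andbT rcons_cat cat_path pd_rev rev_cons last_rcons /=.
  by rewrite -{1}[m]addn0 !pdD.
apply/permP => a; have := iota_qpp a.
(* Integer-valued names for the multiplicities make the equation linear. *)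
have [b def_b]: exists b : nat -> nat, forall n, a n = b n :> nat.
  by exists (fun n => a n).
rewrite -addnA !iotaD count_cat /= !count_cat count_rev /= !def_b.
by rewrite !add0n !addnS !addn0; lia.
Qed.

Lemma growable_ge5 r :
    growable r 5 -> growable r 6 -> growable r 7 -> growable r 8 -> growable r 9 ->
  forall k, 4 < k -> growable r k.
Proof.
move=> g5 g6 g7 g8 g9; elim/ltn_ind=> k IHk k_gt4.
have [k_ge10 | k_lt10] := leqP 10 k.
  rewrite -(subnK (leq_trans (isT : 5 <= 10) k_ge10)).
  by apply/growableD5/IHk; lia.
by move: k k_gt4 k_lt10 {IHk}; do 10![case=> //].
Qed.

Lemma growable_nil k : 4 < k -> growable [::] k.
Proof.
move: k; apply: growable_ge5.
- by apply: (@packing_growable 2 [:: 0; 3; 1; 4]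
    [::]).
- by apply: (@packing_growable 3 [:: 1; 4; 2; 0; 5]
    [::]).
- by apply: (@packing_growable 4 [:: 2; 0; 5; 3; 1; 6]
    [::]).
- by apply: (@packing_growable 5 [:: 0; 3; 1; 6; 4; 2; 7]
    [::]).
- by apply: (@packing_growable 6 [:: 1; 3; 0; 2; 4; 7; 5; 8]
    [::]).
Qed.

Lemma growable_three k : 4 < k -> growable [:: 3] k.
Proof.
move: k; apply: growable_ge5.
- by apply: (@packing_growable 5 [:: 0; 2; 4; 7]
    [:: [:: 1; 3; 6]]).
- by apply: (@packing_growable 6 [:: 1; 3; 0; 5; 8]
    [:: [:: 2; 4; 7]]).
- by apply: (@packing_growable 7 [:: 0; 2; 4; 1; 6; 9]
    [:: [:: 3; 5; 8]]).
- by apply: (@packing_growable 8 [:: 1; 3; 0; 2; 5; 7; 10]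
    [:: [:: 4; 6; 9]]).
- by apply: (@packing_growable 9 [:: 2; 0; 3; 1; 4; 6; 8; 11]
    [:: [:: 5; 7; 10]]).
Qed.

Lemma growable_four k : 4 < k -> growable [:: 4] k.
Proof.
move: k; apply: growable_ge5.
- by apply: (@packing_growable 6 [:: 1; 3; 5; 8]
    [:: [:: 0; 2; 4; 7]]).
- by apply: (@packing_growable 7 [:: 0; 2; 4; 6; 9]
    [:: [:: 1; 3; 5; 8]]).
- by apply: (@packing_growable 8 [:: 1; 3; 0; 2; 5; 10]
    [:: [:: 4; 6; 9; 7]]).
- by apply: (@packing_growable 9 [:: 2; 0; 3; 1; 4; 6; 11]
    [:: [:: 5; 7; 10; 8]]).
- by apply: (@packing_growable 10 [:: 3; 0; 2; 4; 9; 7; 5; 12]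
    [:: [:: 1; 6; 11; 8]]).
Qed.

Lemma growable_two_threes k : 4 < k -> growable [:: 3; 3] k.
Proof.
move: k; apply: growable_ge5.
- by apply: (@packing_growable 8 [:: 1; 3; 5; 10]
    [:: [:: 0; 2; 7]; [:: 4; 6; 9]]).
- by apply: (@packing_growable 9 [:: 2; 0; 3; 8; 11]
    [:: [:: 1; 4; 6]; [:: 5; 7; 10]]).
- by apply: (@packing_growable 10 [:: 3; 0; 2; 5; 7; 12]
    [:: [:: 1; 6; 8]; [:: 4; 9; 11]]).
- by apply: (@packing_growable 11 [:: 0; 2; 4; 1; 3; 6; 13]
    [:: [:: 5; 8; 10]; [:: 7; 9; 12]]).
- by apply: (@packing_growable 12 [:: 1; 3; 0; 2; 4; 6; 9; 14]
    [:: [:: 5; 7; 10]; [:: 8; 11; 13]]).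
Qed.

(** * Combining short cycles *)

Definition short a b : seq nat := nseq a 3 ++ nseq b 4.

Lemma packable_shortD a b c d :
  packable (short a b) -> packable (short c d) -> packable (short (a + c) (b + d)).
Proof.
move=> pack_ab pack_cd; apply: perm_packable (packable_cat pack_ab pack_cd).
by rewrite /short !nseqD perm_catACA.
Qed.

Lemma packable_333 : packable (short 3 0).
Proof. by apply: (@packing_packable 9 [:: [:: 0; 2; 7]; [:: 1; 4; 6]; [:: 3; 5; 8]]). Qed.

Lemma packable_44 : packable (short 0 2).
Proof. by apply: (@packing_packable 8 [:: [:: 0; 2; 5; 7]; [:: 1; 3; 6; 4]]). Qed.

Lemma packable_34 : packable (short 1 1).
Proof. by apply: (@packing_packable 7 [:: [:: 0; 2; 5]; [:: 1; 3; 6; 4]]). Qed.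

(** The three lemmas below reach every multiset of 3s and 4s, except 3, 3 + 3
    and 4: their sums 3, 6 and 4 are too small. *)
Lemma packable_threes a : packable (short a.+3 0).
Proof.
elim/ltn_ind: a => -[|[|[|a]]] IHa.
- exact: packable_333.
- by apply: (@packing_packable 12
    [:: [:: 0; 2; 7]; [:: 1; 3; 6]; [:: 4; 9; 11]; [:: 5; 8; 10]]).
- by apply: (@packing_packable 15
    [:: [:: 0; 2; 5]; [:: 1; 3; 6]; [:: 4; 9; 11]; [:: 7; 12; 14]; [:: 8; 10; 13]]).
exact: (packable_shortD packable_333 (IHa a (leqW (leqnSn _)))).
Qed.

Lemma packable_threes_four a : packable (short a.+1 1).
Proof.
elim/ltn_ind: a => -[|[|[|a]]] IHa.
- exact: packable_34.
- by apply: (@packing_packable 10 [:: [:: 0; 2; 5]; [:: 1; 3; 8]; [:: 4; 6; 9; 7]]).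
- by apply: (@packing_packable 13
    [:: [:: 0; 2; 5]; [:: 1; 3; 8]; [:: 4; 6; 11]; [:: 7; 9; 12; 10]]).
exact: (packable_shortD packable_333 (IHa a (leqW (leqnSn _)))).
Qed.

Lemma packable_threes_fours a b : packable (short a b.+2).
Proof.
elim/ltn_ind: b => -[|[|b]] IHb.
- case: a {IHb} => [|[|[|a]]].
  + exact: packable_44.
  + by apply: (@packing_packable 11 [:: [:: 0; 2; 5]; [:: 1; 3; 10; 8]; [:: 4; 6; 9; 7]]).
  + exact: (packable_shortD packable_34 packable_34).
  by rewrite -[a.+3]addn0; apply: packable_shortD (packable_threes a) packable_44.
- case: a {IHb} => [|a].
    by apply: (@packing_packable 12
      [:: [:: 0; 2; 5; 7]; [:: 1; 3; 10; 8]; [:: 4; 6; 9; 11]]).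
  by rewrite -[a.+1]addn0; apply: packable_shortD (packable_threes_four a) packable_44.
exact: (packable_shortD packable_44 (IHb b (leqnSn _))).
Qed.

Lemma packable_big bs : all (leq 5) bs -> packable bs.
Proof.
elim: bs => [_ | k bs IHbs /= /andP[k_ge5 /IHbs]]; first by exists [::].
exact/(@packable_cat [:: k])/growable_packable/growable_nil.
Qed.

Lemma split_short s : all (leq 3) s ->
  exists a b bs, all (leq 5) bs /\ perm_eq (short a b ++ bs) s.
Proof.
elim: s => [_ | k s IHs /= /andP[k_ge3 /IHs[a [b [bs [bs_ge5 perm_s]]]]]].
  by exists 0, 0, [::].
case: (ltngtP k 4) => [k_lt4 | k_gt4 | ->].
- have -> : k = 3 by apply/eqP; rewrite eqn_leq k_ge3 -ltnS k_lt4.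
  by exists a.+1, b, bs; rewrite /= perm_cons.
- exists a, b, (k :: bs); rewrite /= k_gt4; split=> //.
  by rewrite -cat1s perm_catCA perm_cons.
exists a, b.+1, bs; split=> //.
by rewrite /short -catA /= -cat1s perm_catCA perm_cons catA.
Qed.

(** The lengths 3 and 4 either form a packable multiset, to which the longer
    cycles are appended, or one of the exceptions 3, 3 + 3 and 4; then the total
    forces a length k >= 5, and one such k absorbs the exception. *)
Lemma packable_ge7 s : all (leq 3) s -> 7 <= sumn s -> packable s.
Proof.
move=> s_ge3; have [a [b [bs [bs_ge5 perm_s]]]] := split_short s_ge3.
rewrite -(perm_sumn perm_s) => s_ge7; apply: perm_packable perm_s _.
have pack_short : packable (short a b) -> packable (short a b ++ bs).
  by move=> pack_ab; apply: packable_cat (packable_big bs_ge5).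
have pack_growable : (forall k, 4 < k -> growable (short a b) k) ->
    sumn (short a b) < 7 -> packable (short a b ++ bs).
  case: bs bs_ge5 s_ge7 {pack_short} => [_ | k bs /= /andP[k_ge5 bs_ge5] _ g_k _].
    by rewrite cats0 => le_ab _; rewrite ltnNge le_ab.
  apply: perm_packable (packable_cat (growable_packable (g_k k k_ge5)) (packable_big bs_ge5)).
  by rewrite perm_sym -cat1s perm_catCA.
case: b => [|[|b]] in s_ge7 pack_short pack_growable *; last first.
- exact/pack_short/packable_threes_fours.
- case: a => [|a] in s_ge7 pack_short pack_growable *.
    exact: pack_growable growable_four _.
  exact/pack_short/packable_threes_four.
case: a => [|[|[|a]]] in s_ge7 pack_short pack_growable *.
- exact: packable_big.
- exact: pack_growable growable_three _.
- exact: pack_growable growable_two_threes _.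
exact/pack_short/packable_threes.
Qed.

(** * Realizing a graph whose degrees are two *)

Lemma uniq_mem_flatten (T : eqType) (ss : seq (seq T)) c :
  uniq (flatten ss) -> c \in ss -> uniq c.
Proof.
elim: ss => //= d ss IHss; rewrite cat_uniq => /and3P[Ud _ /IHss Uss].
by rewrite inE => /predU1P[-> | /Uss].
Qed.

(** The packing qq lists its cycles in the order of the cycles ss of F, so that
    the map h sending the i-th entry of flatten ss to the i-th entry of
    flatten qq carries each cycle of F to a cycle of prime differences. *)
Lemma two_regular_embedding (F : sgraph) :
    7 <= #|F| -> (forall v : F, degree v = 2) ->
  exists2 f : F -> 'I_#|F|, injective f &
    forall u v : F, adj u v -> prime_difference_rel (f u) (f v).
Proof.
move=> F_ge7 F_two.
have [ss [Uss mem_ss ess ss_gt2]] := cycle_decomposition (@adj_sym F) (@adj_irr F) F_two.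
have card_ss : sumn (shape ss) = #|F|.
  by rewrite -size_flatten -(card_uniqP Uss); apply: eq_card.
have [||pp pp_ss] := @packable_ge7 (shape ss); rewrite ?card_ss ?all_map //.
case/andP=> pd_pp pp_iota.
(* Reorder the packing so that its lengths come in the order of ss. *)
have [qq def_qq shape_qq] : exists2 qq, perm_eq qq pp & shape qq = shape ss.
  rewrite perm_sym in pp_ss; have [Is Is_iota ->] := perm_iotaP 0 pp_ss.
  rewrite size_map in Is_iota.
  exists [seq nth [::] pp i | i <- Is].
    rewrite -[X in perm_eq _ X](mkseq_nth [::]); exact: perm_map.
  rewrite /shape -map_comp; apply/eq_in_map => i.
  by rewrite (perm_mem Is_iota) mem_iota => /= lt_i; rewrite (nth_map [::]).
have qq_iota : perm_eq (flatten qq) (iota 0 #|F|).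
  exact: perm_trans (perm_flatten def_qq) pp_iota.
have pd_qq : all (cycle prime_dist) qq by rewrite (perm_all _ def_qq).
pose h x := nth 0 (flatten qq) (index x (flatten ss)).
have size_qs : size (flatten qq) = size (flatten ss).
  by rewrite !size_flatten shape_qq.
have map_h : map h (flatten ss) = flatten qq.
  apply: (@eq_from_nth _ 0) => [|i]; rewrite size_map // => lt_i.
  have x0 : F by case: (flatten ss) lt_i.
  by rewrite (nth_map x0) // /h index_uniq.
have map_h_ss : map (map h) ss = qq.
  rewrite -[RHS]flattenK shape_qq -map_h map_flatten.
  rewrite -[LHS]flattenK; congr (reshape _ _).
  by rewrite /shape -map_comp (eq_map (size_map _)).
have h_lt x : h x < #|F|.
  have: h x \in iota 0 #|F|.
    by rewrite -(perm_mem qq_iota) -map_h map_f ?mem_ss.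
  by rewrite mem_iota.
have h_inj : injective h.
  move=> x y eq_h.
  apply: (@index_inj _ x (flatten ss)); rewrite ?mem_ss //.
  have Uqq : uniq (flatten qq) by rewrite (perm_uniq qq_iota) iota_uniq.
  by apply/eqP; rewrite -(nth_uniq 0 _ _ Uqq) ?size_qs ?index_mem ?mem_ss //; apply/eqP.
exists (fun x => Ordinal (h_lt x)) => [x y [/h_inj] // | x y exy].
rewrite prime_difference_relE; change (prime_dist (h x) (h y)).
have /flattenP[c ss_c c_x] : x \in flatten ss by rewrite mem_ss.
have pd_c : cycle (relpre h prime_dist) c.
  by rewrite -cycle_map; apply: (allP pd_qq); rewrite -map_h_ss map_f.
have Uc := uniq_mem_flatten Uss ss_c.
have := cycle_neighbors (@adj_sym F) F_two (allP ess _ ss_c) Uc (allP ss_gt2 _ ss_c) c_x exy.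
case/orP=> /eqP->; first exact: (next_cycle pd_c c_x).
by rewrite prime_dist_sym; apply: (prev_cycle pd_c c_x).
Qed.

Theorem theorem3p2 (n : nat) (hn : 7 <= n)
    (F : subgraph (complete_graph n)) (hF : two_factor F) :
  exists H : subgraph (prime_difference_graph n), isomorphic H F.
Proof.
have [F_span F_two] := hF.
have card_F : #|F| = n.
  have -> : #|F| = #|sub_vertices F| by rewrite /= card_sig.
  by rewrite F_span cardsT card_ord.
have := @two_regular_embedding F; rewrite card_F => /(_ hn F_two) [f f_inj f_adj].
have [g fK gK] : bijective f by apply: inj_card_bij; rewrite ?card_ord ?card_F.
pose e : rel 'I_n := fun u v => adj (g u) (g v).
have e_sym : symmetric e by move=> u v; apply: adj_sym.
have eP u v : e u v ->
    [/\ u \in [set: 'I_n], v \in [set: 'I_n] & @adj (prime_difference_graph n) u v].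
  by move=> /f_adj; rewrite !gK !inE.
exists (@Subgraph (prime_difference_graph n) [set: 'I_n] e e_sym eP).
exists (fun u => g (val u)); split=> //.
exists (fun v => Sub (f v) (in_setT (f v))) => [u | v] /=.
  by apply: val_inj; rewrite /= gK.
exact: fK.
Qed.
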